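(* Let $\widetilde W=\frac12\mathbb I-|\Psi^-\rangle\langle\Psi^-|$ on $\mathbb C^2\otimes\mathbb C^2$, where $|\Psi^-\rangle=\frac{|01\rangle-|10\rangle}{\sqrt2}$. Let $\sigma_0=\mathbb I$, let $\sigma_1,\sigma_2,\sigma_3$ be the Pauli matrices, $\vec\sigma=(\sigma_1,\sigma_2,\sigma_3)$, and $\vec n=\frac1{\sqrt3}(1,1,1)$. (1) For $x,y\in\{0,1,2,3\}$ let $\beta_{x,y}=\frac58$ if $x=y$ and $\beta_{x,y}=-\frac18$ otherwise, and let $\widetilde\tau_x=\sigma_x\frac{\mathbb I+\vec n\cdot\vec\sigma}{2}\sigma_x$, $\widetilde\omega_y=\sigma_y\frac{\mathbb I+\vec n\cdot\vec\sigma}{2}\sigma_y$. Then $\widetilde W=\sum_{x,y}\beta_{x,y}\widetilde\tau_x^T\otimes\widetilde\omega_y^T$ and the MDI-EW $((\beta_{x,y}),\{\widetilde\tau_x\},\{\widetilde\omega_y\},0)$ is sensitive. (2) For $x=(x_1,x_2)$ and $y=(y_1,y_2)$ with $x_1,y_1\in\{0,1\}$ and $x_2,y_2\in\{1,2,3\}$, let $\beta'_{x,y}=\delta_{x_2,y_2}\frac{3\delta_{x_1,y_1}-1}{6}$ (Kronecker deltas), $\widetilde\tau'_x=\frac{\mathbb I+(-1)^{x_1}\sigma_{x_2}}{2}$, $\widetilde\omega'_y=\frac{\mathbb I+(-1)^{y_1}\sigma_{y_2}}{2}$. Then $\widetilde W=\sum_{x,y}\beta'_{x,y}\widetilde\tau_x'^{\,T}\otimes\widetilde\omega_y'^{\,T}$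 and the MDI-EW $((\beta'_{x,y}),\{\widetilde\tau'_x\},\{\widetilde\omega'_y\},0)$ is sensitive.
   Context: A state is a density operator (positive semidefinite, trace one). A POVM operator is a Hermitian operator $E$ with $0\le E\le I$. $T$ denotes transposition in the computational basis $\{|0\rangle,|1\rangle\}$ of $\mathbb C^2$. Below $H_A=H_B=\mathbb C^2$. Entanglement witness (weakly optimal): a Hermitian operator $\widetilde W$ on $H_A\otimes H_B$ such that $\min_{\sigma}\mathrm{Tr}(\widetilde W\sigma)=0$, the minimum being over all separable states $\sigma$, and $\mathrm{Tr}(\widetilde W\rho)<0$ for some entangled state $\rho$. MDI-EW: a tuple $((\beta_{x,y}),\{\widetilde\tau_x\},\{\widetilde\omega_y\},0)$ consisting of a nonzero real matrix $(\beta_{x,y})$ (finite index sets), pure states $\widetilde\tau_x$ on $H_A$ and pure states $\widetilde\omega_y$ on $H_B$, such that the operator $V=\sum_{x,y}\beta_{x,y}\widetilde\tau_x^T\otimes\widetilde\omega_y^T$ is a weakly optimal entanglement witness, i.e. $\min_{\sigma}\mathrm{Tr}(V\sigma)=0$ over all separable states $\sigma$ on $H_A\otimes H_B$ and $\mathrm{Tr}(V\rho)<0$ for some entangled state $\rho$. Sensitive: an MDI-EW $((\beta_{x,y}),\{\widetilde\tau_x\},\{\widetilde\omega_y\},0)$ is sensitive if for every $0<\epsilon\le 1$ there exist states $\tau_x$ on $H_A$ and $\omega_y$ on $H_B$ with $\mathrm{Tr}(\tau_x\widetilde\tau_x)\ge 1-\epsilon$ and $\mathrm{Tr}(\omega_y\widetilde\omega_y)\ge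 1-\epsilon$ for all $x,y$, and POVM operators $A$ on $H_A$ and $B$ on $H_B$, such that $\sum_{x,y}\beta_{x,y}\mathrm{Tr}(A\tau_x)\mathrm{Tr}(B\omega_y)<0$. *)

(* Defs.v *)
From HB Require Import structures.
From mathcomp Require Import all_boot all_order all_algebra.
From mathcomp Require Import sesquilinear spectral.
From mathcomp Require Import complex mxtens reals.
Set Implicit Arguments.
Unset Strict Implicit.
Unset Printing Implicit Defensive.
Import Order.TTheory GRing.Theory Num.Theory.
Local Open Scope ring_scope.
Local Open Scope complex_scope.
Local Open Scope sesquilinear_scope.

(* Vectors of C^n are column matrices over R[i]; [M ^t*] is the adjoint, [*t]
   the Kronecker product.  The order on R[i] is the partial one, in which
   [a <= b] and [a < b] entail that [b - a] is real. *)

Section Operators.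
Context {R : realType}.
Implicit Types m n : nat.

Definition psd n (M : 'M[R[i]]_n) : Prop :=
  M \is hermsymmx /\ forall v : 'cV[R[i]]_n, 0 <= (v ^t* *m M *m v) 0 0.

Definition is_state n (rho : 'M[R[i]]_n) : Prop := psd rho /\ \tr rho = 1.

Definition is_pure n (rho : 'M[R[i]]_n) : Prop :=
  exists psi : 'cV[R[i]]_n,
    (psi ^t* *m psi) 0 0 = 1 /\ rho = psi *m psi ^t*.

Definition is_povm_op n (E : 'M[R[i]]_n) : Prop :=
  [/\ E \is hermsymmx, psd E & psd (1%:M - E)].

Definition separable m n (rho : 'M[R[i]]_(m * n)) : Prop :=
  exists (k : nat) (p : 'I_k -> R)
         (a : 'I_k -> 'M[R[i]]_m) (b : 'I_k -> 'M[R[i]]_n),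
    [/\ forall i, 0 <= p i,
        \sum_i p i = 1,
        forall i, is_state (a i),
        forall i, is_state (b i) &
        rho = \sum_i (p i)%:C *: (a i *t b i)].

Definition entangled m n (rho : 'M[R[i]]_(m * n)) : Prop :=
  is_state rho /\ ~ separable rho.

(* The second and third clauses together say that the minimum of
   [\tr (W *m sigma)] over the separable states is attained and equals 0. *)
Definition weakly_optimal_EW m n (W : 'M[R[i]]_(m * n)) : Prop :=
  [/\ W \is hermsymmx,
      forall sigma : 'M[R[i]]_(m * n), separable sigma -> 0 <= \tr (W *m sigma),
      exists sigma : 'M[R[i]]_(m * n), separable sigma /\ \tr (W *m sigma) = 0 &
      exists rho : 'M[R[i]]_(m * n), entangled rho /\ \tr (W *m rho) < 0].

Definition mdi_op (X Y : finType) m n (beta : X -> Y -> R)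
    (tau : X -> 'M[R[i]]_m) (omega : Y -> 'M[R[i]]_n) : 'M[R[i]]_(m * n) :=
  \sum_x \sum_y (beta x y)%:C *: ((tau x)^T *t (omega y)^T).

(* The last component of the tuple ((beta), (tau), (omega), 0) is always 0 and
   is left out. *)
Definition is_mdi_ew (X Y : finType) m n (beta : X -> Y -> R)
    (tau : X -> 'M[R[i]]_m) (omega : Y -> 'M[R[i]]_n) : Prop :=
  [/\ exists x y, beta x y != 0,
      forall x, is_pure (tau x),
      forall y, is_pure (omega y) &
      weakly_optimal_EW (mdi_op beta tau omega)].

Definition sensitive (X Y : finType) m n (beta : X -> Y -> R)
    (taut : X -> 'M[R[i]]_m) (omegat : Y -> 'M[R[i]]_n) : Prop :=
  forall eps : R, 0 < eps -> eps <= 1 ->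
  exists (tau : X -> 'M[R[i]]_m) (omega : Y -> 'M[R[i]]_n)
         (A : 'M[R[i]]_m) (B : 'M[R[i]]_n),
    [/\ forall x, is_state (tau x) /\ (1 - eps)%:C <= \tr (tau x *m taut x),
        forall y, is_state (omega y) /\ (1 - eps)%:C <= \tr (omega y *m omegat y),
        is_povm_op A, is_povm_op B &
        \sum_x \sum_y (beta x y)%:C * \tr (A *m tau x) * \tr (B *m omega y) < 0].

End Operators.

Section Qubits.
Variable R : realType.

Definition mx2 (a b c d : R[i]) : 'M[R[i]]_2 :=
  \matrix_(i, j) if i == 0 then (if j == 0 then a else b)
                 else (if j == 0 then c else d).

Definition pauli (k : 'I_4) : 'M[R[i]]_2 :=
  match val k with
  | 0%N => 1%:M
  | 1%N => mx2 0 1 1 0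
  | 2%N => mx2 0 (- (0 +i* 1)) (0 +i* 1) 0
  | _ => mx2 1 0 0 (- 1)
  end.

(* The index k : 'I_3 = {0, 1, 2} stands for the Pauli matrix number k + 1. *)
Definition pauli_vec (k : 'I_3) : 'M[R[i]]_2 := pauli (lift ord0 k).

Definition ket (k : 'I_2) : 'cV[R[i]]_2 := delta_mx k 0.

Definition psi_minus : 'cV[R[i]]_(2 * 2) :=
  ((Num.sqrt 2)^-1)%:C *: (ket 0 *t ket 1 - ket 1 *t ket 0).

Definition Wtilde : 'M[R[i]]_(2 * 2) :=
  2^-1 *: 1%:M - psi_minus *m psi_minus ^t*.

Definition nvec : 'rV[R]_3 := (Num.sqrt 3)^-1 *: const_mx 1.

Definition dot_sigma (v : 'rV[R]_3) : 'M[R[i]]_2 :=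
  \sum_k (v 0 k)%:C *: pauli_vec k.

Definition beta1 (x y : 'I_4) : R := if x == y then 5 / 8 else - (1 / 8).

Definition tau1 (x : 'I_4) : 'M[R[i]]_2 :=
  pauli x *m (2^-1 *: (1%:M + dot_sigma nvec)) *m pauli x.

Definition omega1 (y : 'I_4) : 'M[R[i]]_2 :=
  pauli y *m (2^-1 *: (1%:M + dot_sigma nvec)) *m pauli y.

(* x = (x_1, x_2) with x_2 in {1, 2, 3} shifted to 'I_3 = {0, 1, 2}. *)
Definition beta2 (x y : 'I_2 * 'I_3) : R :=
  (x.2 == y.2)%:R * ((3 * (x.1 == y.1)%:R - 1) / 6).

Definition tau2 (x : 'I_2 * 'I_3) : 'M[R[i]]_2 :=
  2^-1 *: (1%:M + (- 1) ^+ x.1 *: pauli_vec x.2).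

Definition omega2 (y : 'I_2 * 'I_3) : 'M[R[i]]_2 :=
  2^-1 *: (1%:M + (- 1) ^+ y.1 *: pauli_vec y.2).

End Qubits.

(* Main.v *)
Require Import Defs.
From mathcomp Require Import all_boot all_order all_algebra.
From mathcomp Require Import complex mxtens reals.
From mathcomp Require Import sesquilinear spectral boolp ring lra.
Import Order.TTheory GRing.Theory Num.Theory.
Local Open Scope ring_scope.
Local Open Scope complex_scope.
Local Open Scope sesquilinear_scope.
Set Implicit Arguments.
Unset Strict Implicit.
Unset Printing Implicit Defensive.

(* [Wtilde] is half of the swap operator, so that
   Tr(Wtilde (a (x) b)) = Tr(a b) / 2, which is nonnegative on product states
   and vanishes on opposite Bloch vectors u, -u.  The swap operator is also half
   of the sum of the sigma_k^T (x) sigma_k^T, k = 0..3, so a decomposition of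
   [Wtilde] into pure qubit states amounts to identities between the moments of
   beta against the vectors (1, r), r the Bloch vectors of the states.
   Sensitivity: take A and B to be the projectors with Bloch vectors u and -u.
   The ideal score is 0, and it is affine in each tau_x.  Since Tr(A tau) = 0
   for the state tau orthogonal to A, an admixture of weight eps to the states
   tau_x can leave the contribution of a single x0 only, chosen negative. *)

Section General.
Variable R : realType.
Local Notation C := R[i].

(** * Positive operators, states and their mixtures *)

Lemma hermsymmxP n (M : 'M[C]_n) : reflect (M ^t* = M) (M \is hermsymmx).
Proof.
apply: (iffP (is_hermitianmxP _ _ _)); rewrite expr0 scale1r => e; exact: esym.
Qed.

Lemma conjC_conjc (z : C) : Num.conj z = z^*%C.
Proof. by []. Qed.

Lemma trmxCE m n (M : 'M[C]_(m, n)) i j : (M ^t*) i j = (M j i)^*%C.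
Proof. by rewrite !mxE. Qed.

Lemma trmxC_mul m n p (M : 'M[C]_(m, n)) (N : 'M[C]_(n, p)) :
  (M *m N) ^t* = N ^t* *m M ^t*.
Proof. by rewrite trmx_mul map_mxM. Qed.

(** Diagonalizing [b] unitarily turns the trace into the sum of the eigenvalues of [b] weighted by
    the diagonal entries of [a] in that eigenbasis; both are values of nonnegative quadratic
    forms. *)
Lemma mxtrace_psd_mul_ge0 n (a b : 'M[C]_n) :
  psd a -> psd b -> 0 <= \tr (a *m b).
Proof.
move=> [_ pa] [hb pb].
have /orthomx_spectralP := hermitian_normalmx hb.
have uP := spectral_unitarymx b.
rewrite invmx_unitary //; set P := spectralmx b in uP *; set d := spectral_diag b.
move=> eb.
have PPt : P *m P ^t* = 1%:M by apply/eqP.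
have quad (M : 'M[C]_n) i : (P *m M *m P ^t*) i i =
    ((row i P) ^t* ^t* *m M *m (row i P) ^t*) 0 0.
  rewrite trmxCK [RHS]mxE [LHS]mxE; apply: eq_bigr => k _.
  congr (_ * _); last by rewrite !mxE.
  by rewrite !mxE; apply: eq_bigr => l _; rewrite !mxE.
have dge i : 0 <= d 0 i.
  have -> : d 0 i = (P *m b *m P ^t*) i i.
    rewrite eb !mulmxA PPt mul1mx -mulmxA PPt mulmx1.
    by rewrite mxE eqxx mulr1n.
  by rewrite quad.
rewrite {1}eb mulmxA mxtrace_mulC !mulmxA mul_mx_diag.
apply: sumr_ge0 => i _; rewrite mxE mulr_ge0 //.
by rewrite quad.
Qed.

Lemma pure_is_state n (rho : 'M[C]_n) : is_pure rho -> is_state rho.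
Proof.
move=> [psi [npsi ->]]; split; last first.
  by rewrite mxtrace_mulC /mxtrace big_ord1.
split; first by apply/hermsymmxP; rewrite trmxC_mul trmxCK.
move=> v; rewrite !mulmxA -mulmxA mxE big_ord1.
have -> : (psi ^t* *m v) 0 0 = Num.conj ((v ^t* *m psi) 0 0).
  rewrite !mxE rmorph_sum; apply: eq_bigr => k _.
  by rewrite !mxE rmorphM /= conjCK mulrC.
exact: mul_conjC_ge0.
Qed.

Lemma psd_convex n (a b : 'M[C]_n) (p : R) : 0 <= p -> p <= 1 ->
  psd a -> psd b -> psd ((1 - p)%:C *: a + p%:C *: b).
Proof.
move=> p0 p1 [/hermsymmxP ha pa] [/hermsymmxP hb pb]; split.
  apply/hermsymmxP; rewrite linearD !linearZ /= map_mxD !map_mxZ /= ha hb.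
  by rewrite !conjC_conjc !conjc_real.
move=> v; rewrite mulmxDr mulmxDl !linearZ -!scalemxAl !mxE.
have := pa v; have := pb v; rewrite !mxE => qb qa.
by rewrite addr_ge0 // mulr_ge0 // ler0c // subr_ge0.
Qed.

Lemma state_convex n (a b : 'M[C]_n) (p : R) : 0 <= p -> p <= 1 ->
  is_state a -> is_state b -> is_state ((1 - p)%:C *: a + p%:C *: b).
Proof.
move=> p0 p1 [pa ta] [pb tb]; split; first exact: psd_convex.
by rewrite mxtraceD !mxtraceZ ta tb !mulr1 -rmorphD /= subrK.
Qed.

Lemma mxtrace_mul_comb n (m a b : 'M[C]_n) (c d : C) :
  \tr (m *m (c *: a + d *: b)) = c * \tr (m *m a) + d * \tr (m *m b).
Proof. by rewrite mulmxDr -!scalemxAr mxtraceD !mxtraceZ. Qed.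

(** The admixture contributes [p] times Tr(a b) >= 0, so a weight [p] costs at most [p] in
    fidelity. *)
Lemma fidelity_mix n (a b : 'M[C]_n) (p : R) : 0 <= p ->
    is_state b -> is_state a -> \tr (a *m a) = 1 ->
  (1 - p)%:C <= \tr (((1 - p)%:C *: a + p%:C *: b) *m a).
Proof.
move=> p0 [pb _] [pa _] taa; rewrite mxtrace_mulC mxtrace_mul_comb taa mulr1 lerDl.
by rewrite mulr_ge0 ?ler0c //; apply: mxtrace_psd_mul_ge0.
Qed.

(** * Traces on tensor products and the score *)

Lemma sum_delta (T : finType) (F : T -> C) (x : T) :
  \sum_y (x == y)%:R * F y = F x.
Proof.
rewrite (bigD1 x) //= eqxx mul1r big1 ?addr0 // => y.
by rewrite eq_sym => /negbTE->; rewrite mul0r.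
Qed.

Lemma sum_mxtens (V : nmodType) m n (F : 'I_(m * n) -> V) :
  \sum_k F k = \sum_i \sum_j F (mxtens_index (i, j)).
Proof.
rewrite pair_bigA (reindex (@mxtens_index m n)) /=.
  by apply: eq_bigr => -[].
by exists (@mxtens_unindex m n) => k _; rewrite (mxtens_indexK, mxtens_unindexK).
Qed.

Lemma mxtrace_tens m n (a : 'M[C]_m) (b : 'M[C]_n) :
  \tr (a *t b) = \tr a * \tr b.
Proof.
rewrite /mxtrace sum_mxtens mulr_suml; apply: eq_bigr => i _.
by rewrite mulr_sumr; apply: eq_bigr => j _; rewrite tensmxE.
Qed.

(** The score is the value of the witness on the product of the transposed effects: the two sets of
    transposes cancel under the trace, as Tr(tau^T A^T) = Tr(A tau). *)
Lemma mxtrace_mdi_op_tens (X Y : finType) m n (beta : X -> Y -> R)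
    (tau : X -> 'M[C]_m) (omega : Y -> 'M[C]_n) (A : 'M[C]_m) (B : 'M[C]_n) :
  \tr (mdi_op beta tau omega *m (A^T *t B^T)) =
  \sum_x \sum_y (beta x y)%:C * \tr (A *m tau x) * \tr (B *m omega y).
Proof.
rewrite mulmx_suml linear_sum; apply: eq_bigr => x _ /=.
rewrite mulmx_suml linear_sum; apply: eq_bigr => y _ /=.
rewrite -scalemxAl mxtraceZ tensmx_mul mxtrace_tens -!trmx_mul !mxtrace_tr.
by rewrite mulrA.
Qed.

(* Mixing a weight [eps] of [a1] into the state number [x0], and of [a0] into
   all the others, leaves only [eps] times the contribution of [x0]. *)
Lemma sensitive_replace (X Y : finType) m n (beta : X -> Y -> R)
    (taut : X -> 'M[C]_m) (omegat : Y -> 'M[C]_n)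
    (A : 'M[C]_m) (B : 'M[C]_n) (a1 a0 : 'M[C]_m) (x0 : X) :
    (forall x, is_state (taut x) /\ \tr (taut x *m taut x) = 1) ->
    (forall y, is_state (omegat y) /\ \tr (omegat y *m omegat y) = 1) ->
    is_povm_op A -> is_povm_op B ->
    is_state a1 /\ \tr (A *m a1) = 1 -> is_state a0 /\ \tr (A *m a0) = 0 ->
    \tr (mdi_op beta taut omegat *m (A^T *t B^T)) = 0 ->
    \sum_y (beta x0 y)%:C * \tr (B *m omegat y) < 0 ->
  sensitive beta taut omegat.
Proof.
move=> ht hw hA hB [s1 tr1] [s0 tr0] V0 neg eps e0 e1.
pose rho x := if x0 == x then a1 else a0.
have st_rho x : is_state (rho x) by rewrite /rho; case: eqP.
have trA_rho x : \tr (A *m rho x) = (x0 == x)%:R by rewrite /rho; case: eqP.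
exists (fun x => (1 - eps)%:C *: taut x + eps%:C *: rho x), omegat, A, B; split=> //.
- move=> x; have [stx trx] := ht x; split.
    by apply: state_convex; [exact: ltW|exact: e1| |].
  by apply: fidelity_mix; [exact: ltW| | |].
- by move=> y; have [sty ->] := hw y; split=> //; rewrite lecR gerBl ltW.
have -> : \sum_x \sum_y (beta x y)%:C *
    \tr (A *m ((1 - eps)%:C *: taut x + eps%:C *: rho x)) * \tr (B *m omegat y) =
  (1 - eps)%:C *
    (\sum_x \sum_y (beta x y)%:C * \tr (A *m taut x) * \tr (B *m omegat y)) +
  eps%:C * \sum_x (x0 == x)%:R * \sum_y (beta x y)%:C * \tr (B *m omegat y).
  rewrite !mulr_sumr -big_split; apply: eq_bigr => x _ /=.
  rewrite !mulr_sumr -big_split; apply: eq_bigr => y _ /=.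
  by rewrite mxtrace_mul_comb trA_rho; ring.
rewrite -mxtrace_mdi_op_tens V0 mulr0 add0r sum_delta.
by rewrite pmulr_rlt0 // ltcR.
Qed.

End General.

Section Qubits.
Variable R : realType.
Local Notation C := R[i].

(** * Qubit operators in Bloch form *)

Definition bloch (r : 'rV[R]_3) : 'M[C]_2 := 2^-1 *: (1%:M + dot_sigma r).

Definition dot (r s : 'rV[R]_3) : R := (r *m s^T) 0 0.

Lemma dotE r s : dot r s = \sum_k r 0 k * s 0 k.
Proof. by rewrite /dot mxE; apply: eq_bigr => k _; rewrite mxE. Qed.

Lemma dotNr r s : dot r (- s) = - dot r s.
Proof. by rewrite /dot linearN mulmxN mxE. Qed.

Lemma dotNl r s : dot (- r) s = - dot r s.
Proof. by rewrite /dot mulNmx mxE. Qed.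

Lemma big_ord3 (V : nmodType) (F : 'I_3 -> V) :
  \sum_k F k = F 0 + F 1 + F 2.
Proof.
rewrite !big_ord_recl big_ord0 addr0 addrA.
by congr (F _ + F _ + F _); apply: val_inj.
Qed.

Lemma ord2_ind (P : 'I_2 -> Prop) : P 0 -> P 1 -> forall i, P i.
Proof. by move=> P0 P1 [[|[|//]] p]; [move: P0|move: P1]; congr P; apply: val_inj. Qed.

Lemma dot3E r s : dot r s = r 0 0 * s 0 0 + r 0 1 * s 0 1 + r 0 2 * s 0 2.
Proof. by rewrite dotE big_ord3. Qed.

Lemma inv2C : 2^-1 = (2^-1 : R)%:C :> C.
Proof. by rewrite fmorphV rmorph_nat. Qed.

Lemma blochE r : bloch r =
  mx2 ((2^-1 * (1 + r 0 2)) +i* 0) ((2^-1 * r 0 0) +i* (- (2^-1 * r 0 1)))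
      ((2^-1 * r 0 0) +i* (2^-1 * r 0 1)) ((2^-1 * (1 - r 0 2)) +i* 0).
Proof.
rewrite /bloch /dot_sigma big_ord3 inv2C; apply/matrixP => i j.
move: i j; apply: ord2_ind; apply: ord2_ind; rewrite !mxE /=; simpc;
  apply/eqP; rewrite eq_complex /=; apply/andP; split; apply/eqP; ring.
Qed.

Lemma mx2_mxtrace (a b c d : C) : \tr (mx2 a b c d) = a + d.
Proof. by rewrite /mxtrace !big_ord_recl big_ord0 addr0 !mxE. Qed.

Lemma mx2_mul (a b c d a' b' c' d' : C) : mx2 a b c d *m mx2 a' b' c' d' =
  mx2 (a * a' + b * c') (a * b' + b * d') (c * a' + d * c') (c * b' + d * d').
Proof.
apply/matrixP; apply: ord2_ind; apply: ord2_ind;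
  by rewrite !mxE !big_ord_recl big_ord0 !mxE /= addr0.
Qed.

Lemma mxtrace_bloch_mul r s : \tr (bloch r *m bloch s) = (2^-1 * (1 + dot r s))%:C.
Proof.
rewrite !blochE mx2_mul mx2_mxtrace dot3E; simpc.
by apply/eqP; rewrite eq_complex /=; apply/andP; split; apply/eqP; by field.
Qed.

Lemma mxtrace_bloch_sqr r : dot r r = 1 -> \tr (bloch r *m bloch r) = 1.
Proof.
by move=> hr; rewrite mxtrace_bloch_mul hr -[1 + 1]/(2) mulVf ?pnatr_eq0.
Qed.

(** For unit [r] this is the projector onto the orthogonal state; its positivity makes [bloch r] a
    POVM operator. *)
Lemma bloch_opp r : 1%:M - bloch r = bloch (- r).
Proof.
rewrite /bloch /dot_sigma.
have -> : \sum_k ((- r) 0 k)%:C *: pauli_vec R k = - dot_sigma r.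
  by rewrite -sumrN; apply: eq_bigr => k _; rewrite mxE rmorphN scaleNr.
rewrite -[X in X - _](_ : 2^-1 *: (1%:M + 1%:M) = 1%:M); last first.
  by rewrite -[1%:M]scale1r -scalerDl scalerA mulVf ?scale1r // pnatr_eq0.
by rewrite -scalerBr opprD addrA addrK.
Qed.

Lemma bloch_pure r : dot r r = 1 -> is_pure (bloch r).
Proof.
rewrite dot3E blochE; set x := r 0 0; set y := r 0 1; set z := r 0 2 => hr.
have := hr.
have [z1|z1] := eqVneq z (-1).
  (* The south pole, where the general formula below would divide by zero: the state is |1>. *)
  have xy0 : x ^+ 2 + y ^+ 2 = 0.
    by move: hr; rewrite z1 mulrNN mulr1 -!expr2 => /eqP; rewrite -subr_eq0 addrK => /eqP.
  have /andP : (x ^+ 2 == 0) && (y ^+ 2 == 0).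
    by rewrite -paddr_eq0 ?sqr_ge0 // xy0 eqxx.
  rewrite !sqrf_eq0 => -[/eqP x0 /eqP y0] _.
  exists (delta_mx 1 0); split.
    by rewrite !mxE !big_ord_recl big_ord0 !mxE /= conjC0 conjC1; simpc.
  rewrite x0 y0 z1; apply/matrixP; apply: ord2_ind; apply: ord2_ind;
    rewrite !mxE big_ord1 !mxE /= ?conjC0 ?conjC1; simpc => //;
    apply/eqP; rewrite eq_complex /=; apply/andP; split; apply/eqP; by field.
move=> _.
have z2 : 0 < 1 + z.
  rewrite ltNge; apply/negP => h; move/eqP: z1; apply.
  have /eqP : (1 + z) ^+ 2 == 0.
    by rewrite eq_le sqr_ge0 andbT; move: (sqr_ge0 x) (sqr_ge0 y); nra.
  by move/eqP; rewrite sqrf_eq0 addrC addr_eq0 => /eqP.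
(* Away from the south pole the first column of [bloch r], proportional to (1 + z, x + iy), spans
   its range; [c] normalizes it. Only the relation [hc] is needed afterwards. *)
pose c := (Num.sqrt (2 * (1 + z)))^-1.
have hc : c ^+ 2 * (2 * (1 + z)) = 1.
  rewrite exprVn sqr_sqrtr; last by rewrite mulr_ge0 // ltW.
  by rewrite mulVf // mulf_neq0 ?pnatr_eq0 // gt_eqF.
clearbody c.
have e2 : 2^-1 = c ^+ 2 * (1 + z) by move: hc; lra.
exists (\col_i if i == 0 then ((1 + z) * c) +i* 0 else (x * c) +i* (y * c)).
rewrite e2; split.
  rewrite !mxE !big_ord_recl big_ord0 !mxE /= !conjC_conjc; simpc.
  apply/eqP; rewrite eq_complex /=; apply/andP; split; apply/eqP; last by ring.
  rewrite -[RHS]hc; move: hr => /(congr1 (fun t => c ^+ 2 * t)) hr; lra.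
have hr' : c ^+ 2 * x ^+ 2 + c ^+ 2 * y ^+ 2 = c ^+ 2 * (1 - z ^+ 2).
  by rewrite -hr; ring.
apply/matrixP; apply: ord2_ind; apply: ord2_ind;
  rewrite !mxE big_ord1 !mxE /= !conjC_conjc; simpc;
  apply/eqP; rewrite eq_complex /=; apply/andP; split; apply/eqP; try ring; lra.
Qed.

(** * The singlet, the swap operator and Pauli expansions *)

Lemma sqrt2V_sqr : (Num.sqrt 2)^-1 ^+ 2 = 2^-1 :> R.
Proof. by rewrite exprVn sqr_sqrtr. Qed.

Lemma psi_minusE (a b : 'I_2) : psi_minus R (mxtens_index (a, b)) 0 =
    ((Num.sqrt 2)^-1 * ((a == 0)%:R * (b == 1)%:R - (a == 1)%:R * (b == 0)%:R))%:C.
Proof.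
rewrite rmorphM rmorphB !rmorphM !rmorph_nat /= /psi_minus.
(* The column index of a product of kets has to be a pair for [tensmxE] to apply. *)
have -> : (0 : 'I_(1 * 1)) = mxtens_index (0, 0) by exact: val_inj.
rewrite mxE; congr (_ * _).
by rewrite mxE [X in _ + X]mxE !tensmxE !mxE !andbT.
Qed.

(** The singlet spans the antisymmetric subspace, so its projector is (I - SWAP)/2. *)
Lemma Wtilde_swap i j k l :
  Wtilde R (mxtens_index (i, j)) (mxtens_index (k, l)) =
  2^-1 * ((i == l) && (j == k))%:R.
Proof.
rewrite /Wtilde mxE [X in _ + X]mxE [X in - X]mxE big_ord1 mxE.
rewrite trmxCE !psi_minusE conjc_real -rmorphM.
rewrite mulrACA -expr2 sqrt2V_sqr mxE (can_eq (@mxtens_indexK _ _)) inv2C.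
rewrite -!(rmorph_nat (real_complex R)) -!rmorphM -rmorphB /=; congr _%:C.
move: i j k l; do 4! apply: ord2_ind; rewrite /=; lra.
Qed.

(* [four_vec r] is (1, r), indexed like the matrices [pauli]. *)
Definition four_vec (r : 'rV[R]_3) (k : 'I_4) : R :=
  if unlift ord0 k is Some j then r 0 j else 1.

Lemma bloch_pauli r : bloch r = 2^-1 *: \sum_k (four_vec r k)%:C *: pauli R k.
Proof.
rewrite /bloch big_ord_recl /four_vec unlift_none scale1r; congr (_ *: (_ + _)).
by apply: eq_bigr => k _; rewrite liftK.
Qed.

Lemma big_ord4 (V : nmodType) (F : 'I_4 -> V) :
  \sum_k F k = F 0 + F 1 + F 2 + F 3.
Proof.
rewrite !big_ord_recl big_ord0 addr0 !addrA.
by congr (F _ + F _ + F _ + F _); apply: val_inj.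
Qed.

Lemma pauli_completeness (i j k l : 'I_2) :
  \sum_m pauli R m i j * pauli R m k l = 2 * ((i == l) && (j == k))%:R.
Proof.
rewrite big_ord4; move: i j k l.
by do 4! apply: ord2_ind; rewrite /pauli /= !mxE /=; simpc;
  apply/eqP; rewrite eq_complex /=; apply/andP; split; apply/eqP; ring.
Qed.

Lemma mxtrace_Wtilde_tens (a b : 'M[C]_2) :
  \tr (Wtilde R *m (a *t b)) = 2^-1 * \tr (a *m b).
Proof.
rewrite /mxtrace sum_mxtens mulr_sumr exchange_big; apply: eq_bigr => i _ /=.
rewrite [(a *m b) i i]mxE mulr_sumr; apply: eq_bigr => j _.
rewrite mxE sum_mxtens (eq_bigr (fun k => \sum_l
   (i == k)%:R * ((j == l)%:R * (2^-1 * (a k j * b l i))))) => [|k _].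
  by rewrite (eq_bigr _ (fun k _ => esym (mulr_sumr _ _ _ _))) !sum_delta.
apply: eq_bigr => l _; rewrite Wtilde_swap tensmxE -mulnb natrM; ring.
Qed.

(** In the Pauli expansion of the sum, the coefficient of sigma_k^T (x) sigma_l^T is a quarter of
    the (k, l) moment. Under the hypothesis only the diagonal terms remain, and Pauli completeness
    sums them to half the swap. *)
Lemma mdi_op_bloch (X Y : finType) (beta : X -> Y -> R)
    (t : X -> 'rV[R]_3) (w : Y -> 'rV[R]_3) :
    (forall k l, \sum_x \sum_y
       beta x y * (four_vec (t x) k * four_vec (w y) l) = (k == l)%:R) ->
  Wtilde R = mdi_op beta (fun x => bloch (t x)) (fun y => bloch (w y)).
Proof.
move=> hb; apply/matrixP => a b.
case: (mxtens_indexP a) => i j; case: (mxtens_indexP b) => k l.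
have -> : mdi_op beta (fun x => bloch (t x)) (fun y => bloch (w y))
    (mxtens_index (i, j)) (mxtens_index (k, l)) =
   4^-1 * \sum_m \sum_n
     (\sum_x \sum_y beta x y * (four_vec (t x) m * four_vec (w y) n))%:C *
       (pauli R m k i * pauli R n l j).
  rewrite /mdi_op summxE.
  rewrite (eq_bigr (fun x => \sum_y (beta x y)%:C * (4^-1 * \sum_m \sum_n
    (four_vec (t x) m * four_vec (w y) n)%:C * (pauli R m k i * pauli R n l j)))) => [|x _].
    under eq_bigr => x _.
      under eq_bigr => y _ do rewrite mulrCA.
      rewrite -mulr_sumr; over.
    rewrite -mulr_sumr; congr (_ * _).
    under eq_bigr => x _.
      under eq_bigr => y _ do
        (rewrite mulr_sumr; under eq_bigr => m _ do rewrite mulr_sumr).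
      rewrite exchange_big; under eq_bigr => m _ do rewrite exchange_big.
      over.
    rewrite exchange_big; apply: eq_bigr => m _.
    rewrite exchange_big; apply: eq_bigr => n _.
    rewrite rmorph_sum mulr_suml; apply: eq_bigr => x _.
    rewrite rmorph_sum mulr_suml; apply: eq_bigr => y _.
    by rewrite [X in _ = X * _]rmorphM -[RHS]mulrA.
  rewrite summxE; apply: eq_bigr => y _; rewrite mxE tensmxE !bloch_pauli.
  congr (_ * _); rewrite !mxE !summxE mulrACA -invfM -natrM; congr (_ * _).
  rewrite mulr_suml; apply: eq_bigr => m _; rewrite mulr_sumr; apply: eq_bigr => n _.
  by rewrite !mxE rmorphM mulrACA.
rewrite Wtilde_swap.
(* The transposes exchange row and column indices, which leaves the swap operator unchanged. *)
rewrite (eq_bigr (fun m => pauli R m k i * pauli R m l j)) => [|m _].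
  rewrite pauli_completeness (eq_sym i) (eq_sym j) andbC.
  by rewrite mulrA; congr (_ * _); field.
rewrite (bigD1 m) //= hb eqxx mul1r big1 ?addr0 // => n.
by rewrite hb eq_sym => /negbTE->; rewrite mul0r.
Qed.

(** * Weak optimality of the witness *)

Lemma Wtilde_hermsym : Wtilde R \is hermsymmx.
Proof.
apply/hermsymmxP; rewrite /Wtilde linearB /= map_mxB trmxC_mul trmxCK.
congr (_ - _); rewrite linearZ /= map_mxZ /= trmx1 map_mx1 conjC_conjc.
by rewrite inv2C conjc_real.
Qed.

Lemma psi_minus_norm : (psi_minus R) ^t* *m psi_minus R = 1%:M.
Proof.
apply/matrixP => i j; rewrite !ord1 !mxE sum_mxtens.
under eq_bigr => a _ do under eq_bigr => b _ do
  rewrite trmxCE !psi_minusE conjc_real -rmorphM mulrACA -expr2 sqrt2V_sqr.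
rewrite !big_ord_recl !big_ord0 /=; simpc.
by apply/eqP; rewrite eq_complex /=; apply/andP; split; apply/eqP; by field.
Qed.

Lemma psi_minus_pure : is_pure (psi_minus R *m (psi_minus R) ^t*).
Proof. by exists (psi_minus R); rewrite psi_minus_norm mxE eqxx. Qed.

Lemma Wtilde_psi_minus : \tr (Wtilde R *m (psi_minus R *m (psi_minus R) ^t*)) = - 2^-1.
Proof.
rewrite /Wtilde mulmxBl -scalemxAl mul1mx mulmxA -[_ *m _ *m psi_minus R]mulmxA.
rewrite psi_minus_norm mulmx1 linearB linearZ /= mxtrace_mulC psi_minus_norm.
by rewrite mxtrace1; field.
Qed.

Definition ez : 'rV[R]_3 := delta_mx 0 2.

Lemma dot_ez r : dot ez r = r 0 2.
Proof. by rewrite dot3E !mxE /= !mul0r !add0r mul1r. Qed.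

Lemma ez_unit : dot ez ez = 1.
Proof. by rewrite dot_ez mxE. Qed.

Lemma separable_tens (a b : 'M[C]_2) : is_state a -> is_state b -> separable (a *t b).
Proof.
move=> sa sb; exists 1, (fun=> 1), (fun=> a), (fun=> b); split=> //.
  by rewrite big_ord1.
by rewrite big_ord1 scale1r.
Qed.

Lemma Wtilde_separable_ge0 (sigma : 'M[C]_(2 * 2)) :
  separable sigma -> 0 <= \tr (Wtilde R *m sigma).
Proof.
move=> [n [p [a [b [p0 _ sa sb ->]]]]].
rewrite mulmx_sumr raddf_sum; apply: sumr_ge0 => i _ /=.
rewrite -scalemxAr mxtraceZ mxtrace_Wtilde_tens.
rewrite !mulr_ge0 ?ler0c ?invr_ge0 ?ler0n //.
by apply: mxtrace_psd_mul_ge0; [case: (sa i)|case: (sb i)].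
Qed.

Lemma Wtilde_weakly_optimal : weakly_optimal_EW (Wtilde R).
Proof.
split; first exact: Wtilde_hermsym.
- exact: Wtilde_separable_ge0.
(* Any product of orthogonal pure states attains the minimum 0. *)
- exists (bloch ez *t bloch (- ez)); split.
    by apply: separable_tens; apply/pure_is_state/bloch_pure; rewrite ?dotNl ?dotNr ?opprK ez_unit.
  by rewrite mxtrace_Wtilde_tens mxtrace_bloch_mul dotNr ez_unit subrr !mulr0.
- have neg : \tr (Wtilde R *m (psi_minus R *m (psi_minus R) ^t*)) < 0.
    by rewrite Wtilde_psi_minus oppr_lt0 invr_gt0 ltr0n.
  exists (psi_minus R *m (psi_minus R) ^t*); split=> //; split.
    exact/pure_is_state/psi_minus_pure.
  (* The witness itself certifies that the singlet is entangled. *)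
  by move=> /Wtilde_separable_ge0/le_gtF; rewrite neg.
Qed.

(** * Criteria in terms of Bloch vectors *)

Lemma is_mdi_ew_bloch (X Y : finType) (beta : X -> Y -> R)
    (t : X -> 'rV[R]_3) (w : Y -> 'rV[R]_3) :
    (exists x y, beta x y != 0) ->
    (forall x, dot (t x) (t x) = 1) -> (forall y, dot (w y) (w y) = 1) ->
    Wtilde R = mdi_op beta (fun x => bloch (t x)) (fun y => bloch (w y)) ->
  is_mdi_ew beta (fun x => bloch (t x)) (fun y => bloch (w y)).
Proof.
move=> b0 ht hw hW; split=> // [x|y|]; try exact: bloch_pure.
by rewrite -hW; exact: Wtilde_weakly_optimal.
Qed.

(** The factor [1 - dot u (w y)] is twice Tr(B omega_y) for B = [bloch (- u)], so the last
    hypothesis says that the contribution of [x0] is negative. *)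
Lemma sensitive_bloch (X Y : finType) (beta : X -> Y -> R)
    (t : X -> 'rV[R]_3) (w : Y -> 'rV[R]_3) (u : 'rV[R]_3) (x0 : X) :
    (forall x, dot (t x) (t x) = 1) -> (forall y, dot (w y) (w y) = 1) ->
    dot u u = 1 ->
    Wtilde R = mdi_op beta (fun x => bloch (t x)) (fun y => bloch (w y)) ->
    \sum_y beta x0 y * (1 - dot u (w y)) < 0 ->
  sensitive beta (fun x => bloch (t x)) (fun y => bloch (w y)).
Proof.
move=> ht hw hu hW hneg.
have stB (r : 'rV[R]_3) : dot r r = 1 -> is_state (bloch r).
  by move=> hr; apply/pure_is_state/bloch_pure.
have hNu : dot (- u) (- u) = 1 by rewrite dotNl dotNr opprK.
have trAB : \tr (bloch u *m bloch (- u)) = 0.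
  by rewrite mxtrace_bloch_mul dotNr hu subrr mulr0.
have povm (r : 'rV[R]_3) : dot r r = 1 -> is_povm_op (bloch r).
  move=> hr; have [pr _] := stB _ hr; split; [exact: pr.1|exact: pr|].
  by rewrite bloch_opp; apply: (stB _ _).1; rewrite dotNl dotNr opprK.
apply: (@sensitive_replace _ _ _ _ _ _ _ _
  (bloch u) (bloch (- u)) (bloch u) (bloch (- u)) x0).
- by move=> x; split; [exact: stB|exact: mxtrace_bloch_sqr].
- by move=> y; split; [exact: stB|exact: mxtrace_bloch_sqr].
- exact: povm.
- exact: povm.
- by split; [exact: stB|exact: mxtrace_bloch_sqr].
- by split; [exact: stB|].
- by rewrite -hW mxtrace_Wtilde_tens -trmx_mul mxtrace_tr mxtrace_mulC trAB mulr0.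
rewrite (eq_bigr (fun y => (2^-1 * (beta x0 y * (1 - dot u (w y))))%:C)) => [|y _].
  by rewrite -rmorph_sum ltcR /= -mulr_sumr pmulr_rlt0 ?invr_gt0.
by rewrite mxtrace_bloch_mul dotNl -rmorphM mulrCA.
Qed.

(** Reduces each half of the theorem to finite computations with real vectors. *)
Lemma mdi_ew_sensitive_bloch (X Y : finType) (beta : X -> Y -> R)
    (taut : X -> 'M[C]_2) (omegat : Y -> 'M[C]_2)
    (t : X -> 'rV[R]_3) (w : Y -> 'rV[R]_3) (u : 'rV[R]_3) (x0 : X) :
    (forall x, taut x = bloch (t x)) -> (forall y, omegat y = bloch (w y)) ->
    (forall x, dot (t x) (t x) = 1) -> (forall y, dot (w y) (w y) = 1) ->
    dot u u = 1 ->
    (forall k l,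
       \sum_x \sum_y beta x y * (four_vec (t x) k * four_vec (w y) l) =
         (k == l)%:R) ->
    \sum_y beta x0 y * (1 - dot u (w y)) < 0 ->
  [/\ Wtilde R = mdi_op beta taut omegat, is_mdi_ew beta taut omegat &
      sensitive beta taut omegat].
Proof.
move=> /funext-> /funext-> ht hw hu hb hneg.
have hW := mdi_op_bloch hb.
split=> //; last exact: sensitive_bloch hneg.
apply: is_mdi_ew_bloch => //; exists x0.
(* If row [x0] of [beta] vanished, the sum in [hneg] would be 0. *)
have [/existsP // | ] := boolP [exists y, beta x0 y != 0].
rewrite negb_exists => /forallP b0; move: hneg; rewrite big1 ?ltxx // => y _.
by move: (b0 y); rewrite negbK => /eqP->; rewrite mul0r.
Qed.

(** * The tetrahedral and the octahedral families *)

Definition invsqrt3 : R := (Num.sqrt 3)^-1.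

Lemma invsqrt3_sqr : invsqrt3 * invsqrt3 = 3^-1.
Proof. by rewrite -expr2 exprVn sqr_sqrtr. Qed.

(* Conjugation by a Pauli matrix flips the two Bloch coordinates along the
   other axes; [lift ord0 k] is the Pauli index of the coordinate [k]. *)
Definition tau1_vec (x : 'I_4) : 'rV[R]_3 :=
  \row_k ((-1) ^+ ((x != 0) && (x != lift ord0 k)) * invsqrt3).

Definition tau2_vec (x : 'I_2 * 'I_3) : 'rV[R]_3 := (-1) ^+ x.1 *: delta_mx 0 x.2.

Lemma ord4_ind (P : 'I_4 -> Prop) : P 0 -> P 1 -> P 2 -> P 3 -> forall i, P i.
Proof.
move=> P0 P1 P2 P3 [[|[|[|[|//]]]] p];
  [move: P0|move: P1|move: P2|move: P3]; congr P; exact: val_inj.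
Qed.

Lemma tau1_bloch x : tau1 R x = bloch (tau1_vec x).
Proof.
rewrite /tau1 -/(bloch _) !blochE /nvec.
move: x; apply: ord4_ind; rewrite /pauli /= ?mul1mx ?mulmx1 ?mx2_mul;
  congr (mx2 _ _ _ _); rewrite !mxE /=; simpc;
  apply/eqP; rewrite eq_complex /=; apply/andP; split; apply/eqP; rewrite /invsqrt3; ring.
Qed.

Lemma tau2_bloch x : tau2 R x = bloch (tau2_vec x).
Proof.
rewrite /tau2 /bloch /dot_sigma; congr (_ *: (_ + _)).
rewrite (bigD1 x.2) //= big1 => [|k /negbTE kx]; last first.
  by rewrite !mxE kx andbF mulr0 scale0r.
by rewrite !mxE !eqxx mulr1 addr0 rmorphXn rmorphN1.
Qed.

(** The four Bloch vectors form a regular tetrahedron: they sum to 0 and their outer products sum to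
    4/3 times the identity. Since [beta1] is 3/4 times the identity matrix minus 1/8 times the
    all-ones matrix, the scalar moment is 3 - 2 = 1, the mixed ones vanish, and the vector block is
    (3/4)(4/3) = 1 times the identity. *)
Lemma beta1_moments k l :
  \sum_x \sum_y
    beta1 R x y * (four_vec (tau1_vec x) k * four_vec (tau1_vec y) l) = (k == l)%:R.
Proof.
have four_vec1 x k' : four_vec (tau1_vec x) k' =
    if k' == 0 then 1 else (-1) ^+ ((x != 0) && (x != k')) * invsqrt3.
  rewrite /four_vec; case: unliftP => [j|] -> //=.
  by rewrite mxE.
have h := invsqrt3_sqr.
move: k l; apply: ord4_ind; apply: ord4_ind; rewrite !big_ord4 /beta1 !four_vec1 /=; lra.
Qed.

Lemma big_pair_sum (T1 T2 : finType) (F : T1 * T2 -> R) :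
  \sum_p F p = \sum_i \sum_j F (i, j).
Proof. by rewrite pair_bigA; apply: eq_bigr => -[]. Qed.

(** The Bloch vectors are the six vertices of an octahedron. Equal signs on an axis weigh 1/3 and
    opposite signs -1/6, so each axis adds 2/3 - 1/3 = 1/3 to the scalar moment and 2/3 + 1/3 = 1 to
    its own diagonal moment; the mixed moments cancel by sign symmetry. *)
Lemma beta2_moments k l :
  \sum_x \sum_y
    beta2 R x y * (four_vec (tau2_vec x) k * four_vec (tau2_vec y) l) = (k == l)%:R.
Proof.
have four_vec2 x k' : four_vec (tau2_vec x) k' =
    if k' == 0 then 1 else (-1) ^+ x.1 * (lift ord0 x.2 == k')%:R.
  rewrite /four_vec; case: unliftP => [j|] -> //=.
  by rewrite !mxE eqxx (inj_eq lift_inj) eq_sym.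
rewrite big_pair_sum.
under eq_bigr => i _ do under eq_bigr => j _ do rewrite big_pair_sum.
move: k l; apply: ord4_ind; apply: ord4_ind;
 rewrite !big_ord_recl !big_ord0 /beta2 !four_vec2 /=; lra.
Qed.

Lemma tau1_vec_unit x : dot (tau1_vec x) (tau1_vec x) = 1.
Proof.
rewrite dot3E !mxE mulrACA -expr2 sqrr_sign mul1r.
rewrite [in X in _ + X + _]mulrACA [in X in _ + X]mulrACA.
rewrite -!expr2 !sqrr_sign !expr2 invsqrt3_sqr; lra.
Qed.

Lemma tau2_vec_unit x : dot (tau2_vec x) (tau2_vec x) = 1.
Proof.
rewrite dotE (bigD1 x.2) //= big1 => [|k /negbTE kx]; last first.
  by rewrite !mxE kx andbF !mulr0.
by rewrite !mxE !eqxx !mulr1 addr0 -expr2 sqrr_sign.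
Qed.

End Qubits.

Theorem mainTheorem4 (R : realType) :
  [/\ Wtilde R = mdi_op (beta1 R) (tau1 R) (omega1 R),
      is_mdi_ew (beta1 R) (tau1 R) (omega1 R) &
      sensitive (beta1 R) (tau1 R) (omega1 R)] /\
  [/\ Wtilde R = mdi_op (beta2 R) (tau2 R) (omega2 R),
      is_mdi_ew (beta2 R) (tau2 R) (omega2 R) &
      sensitive (beta2 R) (tau2 R) (omega2 R)].
Proof.
split.
  apply: (mdi_ew_sensitive_bloch (u := ez R) (x0 := 0)
    (@tau1_bloch R) (@tau1_bloch R)
    (@tau1_vec_unit R) (@tau1_vec_unit R) (ez_unit R) (@beta1_moments R)).
  (* With s = 1/sqrt 3 the third coordinates are s, -s, -s, s and the sum is (1 - 3s)/4, negative
     because s^2 = 1/3 > 1/9. *)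
  rewrite big_ord4 !dot_ez !mxE /beta1 /=.
  have : 0 < invsqrt3 R by rewrite invr_gt0 sqrtr_gt0.
  have := invsqrt3_sqr R; nra.
apply: (mdi_ew_sensitive_bloch (u := ez R) (x0 := (0, 2))
  (@tau2_bloch R) (@tau2_bloch R)
  (@tau2_vec_unit R) (@tau2_vec_unit R) (ez_unit R) (@beta2_moments R)).
(* For the index [(0, 2)] of Bloch vector [ez], the term of [ez] itself vanishes and that of [- ez]
   gives (-1/6) * 2 = -1/3; the other axes have weight 0. *)
rewrite big_pair_sum !big_ord_recl !big_ord0 !dot_ez !mxE /beta2 /=; lra.
Qed.
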